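(* Let $\sigma=\sum_{j=1}^m q_j\delta_{y_j}$ with $y_1<\dots<y_m$, $q_j>0$, $\sum_{j=1}^m q_j=1$, and $\mu=\sum_{i=1}^n p_i\delta_{x_i}$ with $x_1<\dots<x_n$, $p_i>0$, $\sum_{i=1}^n p_i=1$, be probability measures on $\mathbb{R}$. Let $a>0$ and let $\mu_a=(D_a)_\#\mu$, where $D_a(x)=ax$. Then the discrete cumulative distribution transforms of $\mu_a$ and $\mu$ relative to $\sigma$ satisfy $$T_{\mu_a}(y_j)=a\,T_\mu(y_j),\qquad j=1,\dots,m.$$ Equivalently, $T_{\mu_a}=aT_\mu$ pointwise on the support of $\sigma$.
   Context: For a Borel probability measure $\mu$ on $\mathbb{R}$, $F_\mu(x)=\mu((-\infty,x])$ is its cumulative distribution function, and its generalized inverse is $F_\mu^{-1}(s)=\inf\{x\in\mathbb{R}: F_\mu(x)\ge s\}$ for $s\in(0,1]$. The discrete cumulative distribution transform (CDT) of an atomic probability measure $\mu$ relative to $\sigma$ is the map $T_\mu=F_\mu^{-1}\circ F_\sigma$, determined by its values on the support $\{y_1,\dots,y_m\}$ of $\sigma$. The pushforward is $(T_\#\mu)(A)=\mu(T^{-1}(A))$ for Borel sets $A$. $\delta_x$ is the Dirac mass at $x$. *)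

(* Defs.v *)
From HB Require Import structures.
From mathcomp Require Import all_boot all_order all_algebra.
From mathcomp Require Import all_classical all_reals all_analysis.
From mathcomp Require Import measurable_realfun.

Set Implicit Arguments.
Unset Strict Implicit.
Unset Printing Implicit Defensive.

Import Order.TTheory GRing.Theory Num.Theory.
Import numFieldNormedType.Exports.

Local Open Scope classical_set_scope.
Local Open Scope ring_scope.

(* Equality is required on Borel sets only: the values of a measure on other
   sets are meaningless. *)
Definition is_atomic (R : realType) (mu : probability (measurableTypeR R) R)
    (n : nat) (p x : 'I_n -> R) : Prop :=
  forall A : set (measurableTypeR R), measurable A ->
    mu A = (\sum_(i < n) (p i)%:E * \d_(x i) A)%E.

(* The library's cdf is that of a random variable; this is the one of a law. *)
Definition mcdf (R : realType) (mu : probability (measurableTypeR R) R)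
    (x : R) : R :=
  fine (mu `]-oo, x]%classic).

(* Meaningful for s in ]0, 1] when the set below is nonempty and bounded from
   below, which holds whenever mu is finitely supported. Outside this case
   inf returns a default value. *)
Definition quantile (R : realType) (mu : probability (measurableTypeR R) R)
    (s : R) : R :=
  inf [set x : R | s <= mcdf mu x].

(* Only the values on the support of sigma matter; there mcdf sigma takes its
   values in ]0, 1]. *)
Definition cdt (R : realType) (sigma mu : probability (measurableTypeR R) R) :
    R -> R :=
  quantile mu \o mcdf sigma.

Definition msupport (R : realType) (mu : probability (measurableTypeR R) R) :
    set R :=
  [set z | forall U : set R, open U -> U z -> (0 < mu U)%E].

Definition dilation (R : realType) (a : R) :
    measurableTypeR R -> measurableTypeR R :=
  fun x => a * x.

Lemma measurable_dilation (R : realType) (a : R) :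
  measurable_fun [set: measurableTypeR R] (dilation a).
Proof. exact: mulrl_measurable. Qed.

HB.instance Definition _ (R : realType) (a : R) :=
  isMeasurableFun.Build _ _ _ _ (dilation a) (@measurable_dilation R a).

(* distribution mu f is the pushforward of mu by f, as a probability. *)
Definition dilate (R : realType) (a : R)
    (mu : probability (measurableTypeR R) R) :
    probability (measurableTypeR R) R :=
  distribution mu (dilation a).

(* Main.v *)
(* Scaling by [a > 0] turns the cdf [F] of [mu] into [F (_ / a)], so it scales
   every superlevel set of [F] by [a]; the infimum of a set scales with it, even
   when the infimum does not exist, since the default value is [0]. *)

Require Import Defs.
From HB Require Import structures.
From mathcomp Require Import all_boot all_order all_algebra.
From mathcomp Require Import all_classical all_reals all_analysis.
From mathcomp Require Import measurable_realfun.

Import Order.TTheory GRing.Theory Num.Theory.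
Import numFieldNormedType.Exports.

Local Open Scope classical_set_scope.
Local Open Scope ring_scope.

Lemma has_inf_pscale (R : realType) (a : R) (E : set R) :
  0 < a -> has_inf E -> has_inf [set a * x | x in E].
Proof.
move=> a0 [[x Ex] [l lE]]; split; first by exists (a * x), x.
by exists (a * l) => _ [z Ez <-]; rewrite ler_pM2l//; exact: lE.
Qed.

(** Multiplying by [a > 0] preserves order, so [a * inf E] is a lower bound of the scaled set. Only
    this half of the equality is proved directly. *)
Lemma pscale_inf_le (R : realType) (a : R) (E : set R) :
  0 < a -> has_inf E -> a * inf E <= inf [set a * x | x in E].
Proof.
move=> a0 [[x Ex] lE]; apply: lb_le_inf; first by exists (a * x), x.
by move=> _ [z Ez <-]; rewrite ler_pM2l//; exact: ge_inf.
Qed.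

Lemma inf_pscale (R : realType) (a : R) (E : set R) :
  0 < a -> inf [set a * x | x in E] = a * inf E.
Proof.
move=> a0; have ia0 : 0 < a^-1 by rewrite invr_gt0.
have aVK : [set a^-1 * x | x in [set a * x | x in E]] = E.
  by rewrite image_comp -[RHS]image_id; apply: eq_imagel => x _ /=;
    rewrite mulKf// gt_eqF.
have [infE|ninfE] := pselect (has_inf E).
  apply/eqP; rewrite eq_le pscale_inf_le// andbT -ler_pdivrMl//.
  (* The reverse inequality is the same bound for [a^-1] and the scaled set, since scaling back
     recovers [E]. *)
  by rewrite -[in leRHS]aVK pscale_inf_le//; exact: has_inf_pscale.
(* Both infima are the default [0]: an infimum of the scaled set would scale back to one of [E]. *)
rewrite !inf_out ?mulr0// => infaE; apply: ninfE.
by rewrite -aVK; exact: has_inf_pscale.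
Qed.

(** As [a > 0], the preimage of a left half-line under the dilation is again a left half-line, with
    endpoint divided by [a]. *)
Lemma mcdf_dilate (R : realType) (mu : probability (measurableTypeR R) R)
    (a x : R) :
  0 < a -> mcdf (dilate a mu) x = mcdf mu (a^-1 * x).
Proof.
move=> a0; rewrite /mcdf /dilate /distribution /pushforward /=.
congr (fine (mu _)); apply/seteqP; split => z /=;
  by rewrite !in_itv/= /dilation ler_pdivlMl.
Qed.

Lemma quantile_dilate (R : realType) (mu : probability (measurableTypeR R) R)
    (a s : R) :
  0 < a -> quantile (dilate a mu) s = a * quantile mu s.
Proof.
move=> a0; rewrite /quantile -inf_pscale//; congr inf.
(* A point [x] of the superlevel set for [dilate a mu] is the image of [a^-1 * x]. *)
apply/seteqP; split => [x /=|_ [x /= sx <-]]; rewrite mcdf_dilate//.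
  by move=> sx; exists (a^-1 * x) => //; rewrite mulVKf// gt_eqF.
by rewrite mulKf// gt_eqF.
Qed.

Theorem proposition5p4 (R : realType) (m n : nat)
    (q y : 'I_m -> R) (p x : 'I_n -> R)
    (sigma mu : probability (measurableTypeR R) R) (a : R)
    (y_incr : forall i j : 'I_m, (i < j)%N -> y i < y j)
    (q_gt0 : forall j : 'I_m, 0 < q j)
    (q_sum1 : \sum_(j < m) q j = 1)
    (sigmaE : is_atomic sigma q y)
    (x_incr : forall i j : 'I_n, (i < j)%N -> x i < x j)
    (p_gt0 : forall i : 'I_n, 0 < p i)
    (p_sum1 : \sum_(i < n) p i = 1)
    (muE : is_atomic mu p x)
    (a_gt0 : 0 < a) :
  (forall j : 'I_m, cdt sigma (dilate a mu) (y j) = a * cdt sigma mu (y j)) /\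
  (forall z : R, msupport sigma z ->
     cdt sigma (dilate a mu) z = a * cdt sigma mu z).
Proof.
(* Both claims are the quantile identity, at the levels [mcdf sigma (y j)] and [mcdf sigma z]. *)
by split=> [j|z _]; exact: quantile_dilate.
Qed.
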